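(* Let $\mathbb{F}$ be a finite field of characteristic $2$. There is an algorithm which, given a multilinear polynomial $P\in\mathbb{F}[x_1,\dots,x_m]$ (as a list of its nonzero monomials), answers True if and only if $P$ is factorizable. Its running time is polynomial in $m$ and in the number of monomials of $P$.
   Context: A polynomial is multilinear if each of its monomials has degree at most $1$ in each variable. For $\lambda\in\mathbb{F}^m$, let $\mathcal{I}(\lambda)=\langle x_1^2+\lambda_1,\dots,x_m^2+\lambda_m\rangle$ and let $\mathrm{Mult}_\lambda(Q)$ denote the unique multilinear polynomial congruent to $Q$ modulo $\mathcal{I}(\lambda)$ (obtained by repeatedly replacing each $x_i^2$ by $\lambda_i$). A multilinear polynomial $P$ is factorizable if there exist $\ell\in\mathbb{F}^m$ and polynomials $L_1,\dots,L_k$ of total degree at most $1$ such that $P=\mathrm{Mult}_{\ell^2}(L_1\cdots L_k)$, where $\ell^2=(\ell_1^2,\dots,\ell_m^2)$. *)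

(* Defs.v *)
(* Mathematical Components, with multinomials for multivariate polynomials *)
From HB Require Import structures.
From mathcomp Require Import all_boot all_order all_algebra.
From mathcomp Require Import ssrcomplements mpoly.

Set Implicit Arguments.
Unset Strict Implicit.
Unset Printing Implicit Defensive.

Import GRing.Theory.
Local Open Scope ring_scope.

Section Polynomials.
Variables (F : fieldType) (m : nat).
Implicit Types (P Q R : {mpoly F[m]}) (lam ell : 'I_m -> F).

Definition multilinear P : Prop :=
  forall mon : 'X_{1..m}, mon \in msupp P -> forall i : 'I_m, (mon i <= 1)%N.

Definition in_ideal lam Q : Prop :=
  exists q : 'I_m -> {mpoly F[m]},
    Q = \sum_(i < m) q i * ('X_i ^+ 2 + (lam i)%:MP).

Definition mult_monomial lam (mon : 'X_{1..m}) : {mpoly F[m]} :=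
  \prod_(i < m) ((lam i ^+ (mon i)./2)%:MP * 'X_i ^+ odd (mon i)).

(* Replacing x_i^2 by lam_i is reduction modulo x_i^2 + lam_i only in
   characteristic 2.  Lemmas [Mult_multilinear], [Mult_congr] and [Mult_unique]
   characterize [Mult lam Q] as the unique multilinear polynomial congruent to Q
   modulo that ideal. *)
Definition Mult lam Q : {mpoly F[m]} :=
  \sum_(mon <- msupp Q) Q@_mon *: mult_monomial lam mon.

(* [msize L] is 1 + the total degree of L (and 0 for L = 0). *)
Definition factorizable P : Prop :=
  exists (ell : 'I_m -> F) (Ls : seq {mpoly F[m]}),
    (forall L, L \in Ls -> (msize L <= 2)%N) /\
    P = Mult (fun i => ell i ^+ 2) (\prod_(L <- Ls) L).

Lemma mult_monomialE lam mon :
  mult_monomial lam mon =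
  (\prod_(i < m) lam i ^+ (mon i)./2) *: 'X_[[multinom (odd (mon i) : nat) | i < m]].
Proof.
rewrite /mult_monomial big_split /= -mul_mpolyC rmorph_prod /=; congr (_ * _).
by rewrite mpolyXE_id; apply: eq_bigr => i _; rewrite mnmE.
Qed.

Lemma Mult_wE lam Q k : (msize Q <= k)%N ->
  Mult lam Q = \sum_(mon : 'X_{1..m < k}) Q@_mon *: mult_monomial lam mon.
Proof.
move=> le_Qk; rewrite /Mult (big_mksub 'X_{1..m < k}) //=; first last.
- by move=> x; move/msize_mdeg_lt => /leq_trans; apply.
- by rewrite msupp_uniq.
by rewrite big_rmcond //= => j; move/memN_msupp_eq0 ->; rewrite scale0r.
Qed.

Lemma Mult_linear lam a P Q : Mult lam (a *: P + Q) = a *: Mult lam P + Mult lam Q.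
Proof.
pose k := maxn (msize (a *: P + Q)) (maxn (msize P) (msize Q)).
rewrite !(@Mult_wE lam _ k) ?leq_max ?leqnn ?orbT //.
rewrite scaler_sumr -big_split /=; apply: eq_bigr => mon _.
by rewrite mcoeffD mcoeffZ scalerDl scalerA.
Qed.

Lemma Mult0 lam : Mult lam 0 = 0.
Proof. by rewrite /Mult msupp0 big_nil. Qed.

Lemma MultD lam P Q : Mult lam (P + Q) = Mult lam P + Mult lam Q.
Proof. by have := Mult_linear lam 1 P Q; rewrite !scale1r. Qed.

Lemma MultZ lam a P : Mult lam (a *: P) = a *: Mult lam P.
Proof. by have := Mult_linear lam a P 0; rewrite Mult0 !addr0. Qed.

Lemma MultX lam mon : Mult lam 'X_[mon] = mult_monomial lam mon.
Proof. by rewrite /Mult msuppX big_seq1 mcoeffX eqxx scale1r. Qed.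

Lemma Mult_id lam P : multilinear P -> Mult lam P = P.
Proof.
move=> mlP; rewrite [RHS]mpolyE /Mult big_seq [RHS]big_seq.
apply: eq_bigr => mon /mlP le1; congr (_ *: _); rewrite mpolyXE_id.
apply: eq_bigr => i _.
by case: (mon i) (le1 i) => [|[|//]] _; rewrite expr0 mpolyC1 mul1r.
Qed.

Lemma Mult_multilinear lam Q : multilinear (Mult lam Q).
Proof.
move=> mon; rewrite /Mult; elim: (msupp Q) => [|n s IHs].
  by rewrite big_nil msupp0.
rewrite big_cons => /msuppD_le; rewrite mem_cat => /orP[|/IHs//].
rewrite mult_monomialE scalerA => /msuppZ_le; rewrite msuppX inE => /eqP-> i.
by rewrite mnmE; case: odd.
Qed.

Lemma in_ideal0 lam : in_ideal lam 0.
Proof. by exists (fun=> 0); rewrite big1 // => i _; rewrite mul0r. Qed.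

Lemma in_idealD lam P Q : in_ideal lam P -> in_ideal lam Q -> in_ideal lam (P + Q).
Proof.
move=> [p ->] [q ->]; exists (fun i => p i + q i).
by rewrite -big_split; apply: eq_bigr => i _; rewrite mulrDl.
Qed.

Lemma in_idealM lam R P : in_ideal lam P -> in_ideal lam (R * P).
Proof.
move=> [p ->]; exists (fun i => R * p i).
by rewrite mulr_sumr; apply: eq_bigr => i _; rewrite mulrA.
Qed.

Lemma in_ideal_gen lam i : in_ideal lam ('X_i ^+ 2 + (lam i)%:MP).
Proof.
exists (fun j => (j == i)%:R); rewrite (bigD1 i) //= eqxx mul1r big1 ?addr0 //.
by move=> j /negbTE->; rewrite mul0r.
Qed.

Hypothesis charF : 2%N \in [pchar F].

Let pchar2P : 2%N \in [pchar {mpoly F[m]}].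
Proof. by rewrite inE /= -mpolyC_nat (pcharf0 charF) mpolyC0. Qed.

Lemma Mult_ideal lam Q : in_ideal lam Q -> Mult lam Q = 0.
Proof.
move=> [q ->].
have sumM (s : seq 'I_m) G : Mult lam (\sum_(i <- s) G i) = \sum_(i <- s) Mult lam (G i).
  by elim: s => [|i s IHs]; rewrite ?big_nil ?Mult0 // !big_cons MultD IHs.
rewrite sumM big1 // => i _; elim/mpolyind: (q i) => [|c mon p _ _ IHp].
  by rewrite mul0r Mult0.
rewrite mulrDl MultD IHp addr0 -scalerAl MultZ mulrDr MultD.
suff -> : Mult lam ('X_[mon] * 'X_i ^+ 2) = Mult lam ('X_[mon] * (lam i)%:MP).
  by rewrite (addrr_pchar2 pchar2P) scaler0.
rewrite [_ * _%:MP]mulrC mul_mpolyC MultZ mpolyXn -mpolyXD !MultX.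
rewrite /mult_monomial [in LHS](bigD1 i) //= [in RHS](bigD1 i) //= -mul_mpolyC.
rewrite !mulrA -mpolyCM mnmDE mulmnE mnm1E eqxx mul1n addn2 /= negbK exprS.
congr (_ * _); apply: eq_bigr => j ji.
by rewrite mnmDE mulmnE mnm1E eq_sym (negbTE ji) addn0.
Qed.

Lemma Mult_congr lam Q : in_ideal lam (Q - Mult lam Q).
Proof.
pose cg P R := in_ideal lam (P - R).
have cgM P P' R R' : cg P P' -> cg R R' -> cg (P * R) (P' * R').
  move=> cP cR; rewrite /cg; have -> : P * R - P' * R' = R * (P - P') + P' * (R - R').
    by rewrite !mulrBr [R * P]mulrC [R * P']mulrC addrA subrK.
  by apply: in_idealD; apply: in_idealM.
have cgn P : cg P P by rewrite /cg subrr; apply: in_ideal0.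
have cgE i k : cg (('X_i ^+ 2) ^+ k) (lam i ^+ k)%:MP.
  elim: k => [|k IHk]; first by rewrite !expr0 mpolyC1; apply: cgn.
  rewrite exprS [lam i ^+ _]exprS mpolyCM; apply: cgM => //.
  by rewrite /cg (oppr_pchar2 pchar2P); apply: in_ideal_gen.
have cgX i n : cg ('X_i ^+ n) ((lam i ^+ n./2)%:MP * 'X_i ^+ odd n).
  rewrite -{1}(odd_double_half n) addnC exprD -mul2n exprM.
  by apply: cgM; [apply: cgE|apply: cgn].
rewrite /Mult {1}[Q]mpolyE -sumrB.
apply: (big_ind (in_ideal lam)) => [|P R|mon _]; [exact: in_ideal0|exact: in_idealD|].
rewrite -scalerBr -mul_mpolyC; apply: in_idealM.
rewrite mpolyXE_id; change (cg (\prod_(i < m) 'X_i ^+ mon i) (mult_monomial lam mon)).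
by apply: (big_ind2 cg) => // P P' R R'; apply: cgM.
Qed.

Lemma Mult_unique lam Q R :
  multilinear R -> in_ideal lam (Q - R) -> R = Mult lam Q.
Proof.
move=> mlR /Mult_ideal QR; rewrite -(subrK R Q) MultD QR add0r.
by rewrite Mult_id.
Qed.

End Polynomials.

(* Model of computation: a first-order call-by-value functional language over
   binary trees with leaves in F, with unit cost per evaluated construct, in the
   style of N. Jones's tree languages (Computability and Complexity from a
   Programming Perspective).  For a fixed finite F it is polynomially equivalent
   to Turing machines: pairing shares its arguments, so on a pointer machine every
   construct takes a time that depends on the program and on F only; in particular
   no construct compares or copies trees. *)

Section Programs.
Variable F : fieldType.

Inductive tree : Type :=
| Leaf of F
| Node of tree & tree.

(* The tree [Leaf 0] plays the roles of the empty list, of False, and of the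
   result of meaningless operations. *)
Definition nil_tree : tree := Leaf 0.

Definition tree_fst (v : tree) : tree := if v is Node l _ then l else nil_tree.
Definition tree_snd (v : tree) : tree := if v is Node _ r then r else nil_tree.
Definition tree_op1 (op : F -> F) (v : tree) : tree :=
  if v is Leaf a then Leaf (op a) else nil_tree.
Definition tree_op2 (op : F -> F -> F) (v w : tree) : tree :=
  if v is Leaf a then if w is Leaf b then Leaf (op a b) else nil_tree else nil_tree.
Definition tree_true (v : tree) : bool := if v is Leaf a then a != 0 else true.

(* Variables are de Bruijn indices; functions take one argument (tuples are
   passed as trees) and are referred to by their index in the program. *)
Inductive expr : Type :=
| Var of nat
| Cst of F
| Pair of expr & expr
| Fst of expr
| Snd of expr
| Add of expr & expr
| Mul of expr & expr
| Inv of expr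
| If of expr & expr & expr
| Let of expr & expr
| Call of nat & expr.

Definition program : Type := seq expr.

Definition body (p : program) (f : nat) : expr := nth (Cst 0) p f.

(* [eval p env e v t]: in environment [env], [e] evaluates to [v] in [t] steps. *)
Inductive eval (p : program) : seq tree -> expr -> tree -> nat -> Prop :=
| EvalVar env i : eval p env (Var i) (nth nil_tree env i) 1
| EvalCst env a : eval p env (Cst a) (Leaf a) 1
| EvalPair env e1 e2 v1 v2 t1 t2 :
    eval p env e1 v1 t1 -> eval p env e2 v2 t2 ->
    eval p env (Pair e1 e2) (Node v1 v2) (t1 + t2).+1
| EvalFst env e v t : eval p env e v t -> eval p env (Fst e) (tree_fst v) t.+1
| EvalSnd env e v t : eval p env e v t -> eval p env (Snd e) (tree_snd v) t.+1
| EvalAdd env e1 e2 v1 v2 t1 t2 :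
    eval p env e1 v1 t1 -> eval p env e2 v2 t2 ->
    eval p env (Add e1 e2) (tree_op2 +%R v1 v2) (t1 + t2).+1
| EvalMul env e1 e2 v1 v2 t1 t2 :
    eval p env e1 v1 t1 -> eval p env e2 v2 t2 ->
    eval p env (Mul e1 e2) (tree_op2 *%R v1 v2) (t1 + t2).+1
| EvalInv env e v t :
    eval p env e v t -> eval p env (Inv e) (tree_op1 (@GRing.inv F) v) t.+1
| EvalIfTrue env e e1 e2 v v1 t t1 :
    eval p env e v t -> tree_true v -> eval p env e1 v1 t1 ->
    eval p env (If e e1 e2) v1 (t + t1).+1
| EvalIfFalse env e e1 e2 v v2 t t2 :
    eval p env e v t -> ~~ tree_true v -> eval p env e2 v2 t2 ->
    eval p env (If e e1 e2) v2 (t + t2).+1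
| EvalLet env e1 e2 v1 v2 t1 t2 :
    eval p env e1 v1 t1 -> eval p (v1 :: env) e2 v2 t2 ->
    eval p env (Let e1 e2) v2 (t1 + t2).+1
| EvalCall env f e v w t1 t2 :
    eval p env e v t1 -> eval p [:: v] (body p f) w t2 ->
    eval p env (Call f e) w (t1 + t2).+1.

(* Execution starts in function 0. *)
Definition runs (p : program) (input output : tree) (time : nat) : Prop :=
  eval p [:: input] (body p 0) output time.

Lemma eval_det p env e v t v' t' :
  eval p env e v t -> eval p env e v' t' -> v = v' /\ t = t'.
Proof.
move=> ev; elim: ev v' t' => {env e v t}; intros;
  match goal with H : eval _ _ _ v' t' |- _ => inversion H; subst; clear H end;
  repeat match goal with
  | IH : forall v' t', eval _ ?env ?e v' t' -> _, H : eval _ ?env ?e _ _ |- _ =>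
      have [? ?] := IH _ _ H; subst; clear H
  end; try by split.
all: by match goal with H1 : is_true ?b, H2 : is_true (~~ ?b) |- _ =>
  rewrite H1 in H2 end.
Qed.

Definition encode_bool (b : bool) : tree := Leaf b%:R.

Definition encode_list (s : seq tree) : tree := foldr Node nil_tree s.

(* A monomial of P is given by its coefficient and its exponent vector, which is
   a 0/1 vector since P is multilinear. *)
Definition encode_monomial (m : nat) (P : {mpoly F[m]}) (mon : 'X_{1..m}) : tree :=
  Node (Leaf P@_mon) (encode_list [seq Leaf (mon i)%:R | i <- enum 'I_m]).

(* The number of variables is given in unary, since it cannot be read off the
   list of monomials when P = 0. *)
Definition encode_poly (m : nat) (P : {mpoly F[m]}) (s : seq 'X_{1..m}) : tree :=
  Node (encode_list (nseq m nil_tree)) (encode_list [seq encode_monomial P mon | mon <- s]).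

End Programs.

(* Main.v *)
Require Import Defs.
From HB Require Import structures.
From mathcomp Require Import all_boot all_order all_algebra.
From mathcomp Require Import mpoly.
From mathcomp Require Import ring zify.

(* For distinct i, j, k let Q_ijk(P) = P P_ijk + P_i P_jk + P_j P_ik + P_k P_ij,
   where indices are partial derivatives.  A multilinear P is factorizable iff
   all Q_ijk(P) vanish as polynomials, a condition that does not involve ell.

   If L is affine with linear coefficients b_l, then Mult(L P) = L P + D P with
   D = sum_l b_l (x_l^2 + lam_l) d/dx_l.  In characteristic 2 the coefficients of
   D are killed by all derivations, and expanding Q_ijk(L P + D P) shows that it
   vanishes with the Q(P).  So products of affine polynomials satisfy the Q.

   Conversely take ell with P(ell) <> 0 and put y_i = x_i + ell_i.  Modulo the
   ideal, y_i^2 = 0, P^2 is the scalar P(ell)^2, and P P_i is affine because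
   d_j d_k (P P_i) = Q_ijk(P) = 0.  Thus A = P P_i / P(ell)^2 is affine,
   P + y_i P_i = P (1 + y_i A), and 1 + y_i A is a product of four affine
   polynomials and its own inverse.  As P + y_i P_i no longer depends on x_i,
   iterating over i leaves a constant.

   If P is a sum of monomial terms M_1, ..., M_N, then
   Q_ijk(P) = d_i d_j d_k (sum_(p < q) M_p M_q).  So it suffices to check that
   the coefficients of sum_(p < q) M_p M_q vanish at all exponent vectors with at
   least three odd entries. *)

Set Implicit Arguments.
Unset Strict Implicit.
Unset Printing Implicit Defensive.

Import GRing.Theory.
Local Open Scope ring_scope.

(** * The quadrics and multiplication by affine polynomials *)

(** The [d] variables stand for D applied to p and its derivatives. Up to even multiples, Q_ijk(L p
    + d) has [q] at L^2, [s] = D([q]) at L, the relations [rjk], [rik], [rij] at bi, bj, bk, and the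
    remainder [DD] = Q_ijk(d). *)
Lemma quad_mul_identity (R : idomainType) (p pi pj pk pij pik pjk pijk : R)
    (d di dj dk dij dik djk dijk L bi bj bk : R) :
  2%:R = 0 :> R -> p != 0 ->
  p * pijk + pi * pjk + pj * pik + pk * pij = 0 ->
  p * dij + d * pij + pi * dj + pj * di = 0 ->
  p * dik + d * pik + pi * dk + pk * di = 0 ->
  p * djk + d * pjk + pj * dk + pk * dj = 0 ->
  pi * djk + p * dijk + di * pjk + d * pijk + pij * dk + pj * dik + pik * dj + pk * dij = 0 ->
  (L * p + d) * (L * pijk + bi * pjk + bj * pik + bk * pij + dijk) +
  (L * pi + bi * p + di) * (L * pjk + bj * pk + bk * pj + djk) +
  (L * pj + bj * p + dj) * (L * pik + bi * pk + bk * pi + dik) +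
  (L * pk + bk * p + dk) * (L * pij + bi * pj + bj * pi + dij) = 0.
Proof.
move=> two0 p0; set q := (X in X = 0 -> _) => q0.
set rij := (X in X = 0 -> _) => rij0; set rik := (X in X = 0 -> _) => rik0.
set rjk := (X in X = 0 -> _) => rjk0; set s := (X in X = 0 -> _) => s0.
set DD := d * dijk + di * djk + dj * dik + dk * dij.
have DD0 : DD = 0.
  (* The hypotheses only give p^2 DD = 0. *)
  apply: (mulfI p0); apply: (mulfI p0); rewrite !mulr0.
  transitivity (p * d * s + p * (di * rjk + dj * rik + dk * rij)
      + d * (pi * rjk + pj * rik + pk * rij) + d * d * q
      - 2%:R * (d * d * (p * pijk + pi * pjk + pij * pk + pik * pj)
        + d * di * (p * pjk + pj * pk) + d * dj * (p * pik + pi * pk)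
        + d * dk * (p * pij + pi * pj) + d * p * (dij * pk + dik * pj + djk * pi)
        + p * (di * dj * pk + di * dk * pj + dj * dk * pi))).
    by rewrite /DD /q /s /rij /rik /rjk; ring.
  by rewrite two0 q0 s0 rij0 rik0 rjk0; ring.
transitivity (L * L * q + L * s + bi * rjk + bj * rik + bk * rij + DD
    + 2%:R * (L * (bi * (p * pjk + pj * pk) + bj * (p * pik + pi * pk)
        + bk * (p * pij + pi * pj))
      + p * (bi * bj * pk + bi * bk * pj + bj * bk * pi))).
  by rewrite /DD /q /s /rij /rik /rjk; ring.
by rewrite two0 q0 s0 rij0 rik0 rjk0 DD0; ring.
Qed.

(** Since D commutes with the derivations, T x = L x + D x satisfies del_u (T x) = T (del_u x) + b_u
    x. This brings all derivatives of Q to the shape treated by [quad_mul_identity]. *)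
Lemma quad_mul_derivations (R : idomainType) (I : Type) (del : I -> R -> R)
    (D : R -> R) (L P : R) (b : I -> R) :
  2%:R = 0 :> R -> P != 0 ->
  (forall i, del i 0 = 0) ->
  (forall i, {morph del i : x y / x + y}) ->
  (forall i x y, del i (x * y) = del i x * y + x * del i y) ->
  (forall i j x, del i (del j x) = del j (del i x)) ->
  (forall i x, del i (D x) = D (del i x)) ->
  (forall i, del i L = b i) -> (forall i j, del i (b j) = 0) ->
  (forall i j k, P * del k (del j (del i P)) + del i P * del k (del j P)
    + del j P * del k (del i P) + del k P * del j (del i P) = 0) ->
  (forall i j, P * D (del j (del i P)) + D P * del j (del i P)
    + del i P * D (del j P) + del j P * D (del i P) = 0) ->
  forall i j k, let Q := L * P + D P in
    Q * del k (del j (del i Q)) + del i Q * del k (del j Q)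
    + del j Q * del k (del i Q) + del k Q * del j (del i Q) = 0.
Proof.
move=> two0 P0 del0 delD delM delC delDC delL delb qP rP i j k Q.
pose T x := L * x + D x.
have delT u x : del u (T x) = T (del u x) + b u * x.
  by rewrite /T delD delM delL delDC; ring.
have delbM u v x : del u (b v * x) = b v * del u x.
  by rewrite delM delb mul0r add0r.
rewrite /Q -/(T P) !(delT, delD, delbM).
(* The relation [s] of [quad_mul_identity] is the i-th derivative of the relation for j and k. *)
have s0 := congr1 (del i) (rP j k).
rewrite del0 !delD !delM !delDC (delC i k (del j P)) (delC i j P) (delC i k P) in s0.
have := @quad_mul_identity R P _ _ _ _ _ _ _ (D P) _ _ _ _ _ _ (D (del k (del j (del i P))))
  L (b i) (b j) (b k) two0 P0 (qP i j k) (rP i j) (rP i k) (rP j k).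
rewrite /T => H; rewrite -[RHS]H; first by ring.
by rewrite -[RHS]s0; ring.
Qed.

Section Quadrics.
Variables (F : fieldType) (m : nat).
Hypothesis charF : 2%N \in [pchar F].
Implicit Types (P Q R L : {mpoly F[m]}) (i j k l : 'I_m) (lam : 'I_m -> F).

Lemma pchar2_mpoly : 2%N \in [pchar {mpoly F[m]}].
Proof. by rewrite inE /= -mpolyC_nat (pcharf0 charF) mpolyC0. Qed.

Let addPP P : P + P = 0. Proof. exact: (addrr_pchar2 pchar2_mpoly). Qed.

Lemma mulrn_pchar2 (a : F) n : a *+ n = a *+ odd n.
Proof.
rewrite -{1}[n]odd_double_half mulrnDr -mul2n mulrnA mulr2n.
by rewrite (addrr_pchar2 charF) mul0rn addr0.
Qed.

(** The two derivations multiply a coefficient by a product of two consecutive integers, which is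
    even. *)
Lemma mderiv_mderiv_pchar2 i P : P^`M(i)^`M(i) = 0.
Proof.
apply/mpolyP => mu; rewrite !mcoeff_mderiv mcoeff0 -mulrnA mulrn_pchar2.
by rewrite mnmDE mnm1E eqxx addn1 oddM /=; case: odd.
Qed.

Definition quad_at i j k P : {mpoly F[m]} :=
  P * P^`M(i)^`M(j)^`M(k) + P^`M(i) * P^`M(j)^`M(k)
  + P^`M(j) * P^`M(i)^`M(k) + P^`M(k) * P^`M(i)^`M(j).

(** All triples are allowed, so that sums over every index l need no case distinction; repeated
    indices impose nothing new, by [quad_distinct]. *)
Definition quad P : Prop := forall i j k, quad_at i j k P = 0.

Lemma quad_at_diag i k P : quad_at i i k P = 0.
Proof.
rewrite /quad_at !mderiv_mderiv_pchar2 mderiv0 !mulr0 add0r addr0.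
exact: addPP.
Qed.

Section Step.
Variables (lam : 'I_m -> F) (b : 'I_m -> F).

Let e l : {mpoly F[m]} := 'X_l ^+ 2 + (lam l)%:MP.

(** The derivation D, which sends x_l to b_l (x_l^2 + lam_l). *)
Definition lift_deriv P := \sum_l b l *: (e l * P^`M(l)).

Lemma mderiv_lift_deriv i P : (lift_deriv P)^`M(i) = lift_deriv P^`M(i).
Proof.
rewrite /lift_deriv raddf_sum; apply: eq_bigr => l _ /=.
rewrite mderivZ mderivM mderiv_comm /e mderivD mderivC addr0 expr2 mderivM.
by rewrite [_^`M(i) * 'X_l]mulrC addPP mul0r add0r.
Qed.

Lemma lift_deriv0 : lift_deriv 0 = 0.
Proof. by rewrite /lift_deriv big1 // => l _; rewrite mderiv0 mulr0 scaler0. Qed.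

(** The left side is the sum over l of b_l (x_l^2 + lam_l) Q_ijl(P). *)
Lemma quad_lift_deriv i j P : quad P ->
  P * lift_deriv P^`M(i)^`M(j) + lift_deriv P * P^`M(i)^`M(j)
  + P^`M(i) * lift_deriv P^`M(j) + P^`M(j) * lift_deriv P^`M(i) = 0.
Proof.
move=> qP; have mulE X Y : X * lift_deriv Y = \sum_l b l *: (X * (e l * Y^`M(l))).
  by rewrite /lift_deriv mulr_sumr; apply: eq_bigr => l _; rewrite -scalerAr.
rewrite [lift_deriv P * _]mulrC !mulE -!big_split /=.
rewrite big1 // => l _; rewrite -!scalerDr.
have := qP i j l; rewrite /quad_at; set S := (X in X = 0).
move=> S0; suff -> : forall Z, Z = e l * S -> b l *: Z = 0 by [|rewrite /S; ring].
by move=> Z ->; rewrite S0 mulr0 scaler0.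
Qed.

Lemma quad_mul_affine L P : (forall i, L^`M(i) = (b i)%:MP) -> quad P ->
  quad (L * P + lift_deriv P).
Proof.
move=> dL qP i j k.
(* [quad_mul_derivations] cancels P, so P = 0 is treated apart. *)
have [->|P0] := eqVneq P 0.
  by rewrite lift_deriv0 mulr0 addr0 /quad_at !mderiv0 !mulr0 !addr0.
have two0 : 2%:R = 0 :> {mpoly F[m]} by exact: pcharf0 pchar2_mpoly.
apply: (@quad_mul_derivations _ _ (@mderiv m F) lift_deriv L P (fun i => (b i)%:MP) two0 P0).
- exact: mderiv0.
- exact: mderivD.
- exact: mderivM.
- by move=> u v x; rewrite mderiv_comm.
- exact: mderiv_lift_deriv.
- exact: dL.
- by move=> u v; rewrite mderivC.
- exact: qP.
- by move=> u v; apply: quad_lift_deriv.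
Qed.
End Step.
End Quadrics.

(** * Multiplication by affine polynomials modulo the ideal *)

Section Reduction.
Variables (F : fieldType) (m : nat).
Hypothesis charF : 2%N \in [pchar F].
Implicit Types (P Q R L : {mpoly F[m]}) (i j k l : 'I_m) (lam ell : 'I_m -> F).

Let oppP P : - P = P. Proof. exact: (oppr_pchar2 (pchar2_mpoly m charF)). Qed.

Lemma multilinearD P Q : multilinear P -> multilinear Q -> multilinear (P + Q).
Proof.
move=> mlP mlQ mu /msuppD_le; rewrite mem_cat => /orP[]; first exact: mlP.
exact: mlQ.
Qed.

Lemma multilinearZ a P : multilinear P -> multilinear (a *: P).
Proof. by move=> mlP mu /msuppZ_le; apply: mlP. Qed.

Lemma multilinearC a : multilinear (a%:MP : {mpoly F[m]}).
Proof.
move=> mu; rewrite mcoeff_msupp mcoeffC; have [-> _ i|_] := eqVneq mu 0%MM.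
  by rewrite mnm0E.
by rewrite mulr0 eqxx.
Qed.

Lemma multilinear_mderiv i P : multilinear P -> multilinear P^`M(i).
Proof.
move=> mlP mu; rewrite mcoeff_msupp mcoeff_mderiv => nz j.
have /mlP/(_ j) : (mu + U_(i))%MM \in msupp P.
  by rewrite mcoeff_msupp; apply: contra nz => /eqP->; rewrite mul0rn.
by rewrite mnmDE; apply: leq_trans; apply: leq_addr.
Qed.

Lemma multilinear_mulX i P :
  (forall mu, mu \in msupp P -> mu i = 0%N) -> multilinear P -> multilinear ('X_i * P).
Proof.
move=> P0 mlP mu; rewrite mulrC (perm_mem (msuppMX P U_(i))) => /mapP[nu nuP ->] j.
by rewrite mnmDE mnm1E; case: eqVneq => [<-|_]; [rewrite P0|apply: mlP].
Qed.

Lemma mderiv_msupp0 i P mu : multilinear P -> mu \in msupp P^`M(i) -> mu i = 0%N.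
Proof.
move=> mlP; rewrite mcoeff_msupp mcoeff_mderiv => nz.
have /mlP/(_ i) : (mu + U_(i))%MM \in msupp P.
  by rewrite mcoeff_msupp; apply: contra nz => /eqP->; rewrite mul0rn.
by rewrite mnmDE mnm1E eqxx addn1; case: (mu i).
Qed.

(** Writing P = A + x_i B with A and B free of x_i, the sum is A + 2 x_i B = A. *)
Lemma msupp_free i P mu : multilinear P ->
  mu \in msupp (P + 'X_i * P^`M(i)) -> mu i = 0%N.
Proof.
move=> mlP muPi; have ml : multilinear (P + 'X_i * P^`M(i)).
  apply: multilinearD => //; apply: multilinear_mulX; last exact: multilinear_mderiv.
  by move=> nu; apply: mderiv_msupp0.
have := ml _ muPi i; case: (posnP (mu i)) => // mui_gt0 mui_le1.
move: muPi; rewrite mcoeff_msupp => /negP[].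
have /submK <- : (U_(i) <= mu)%MM.
  by apply/mnm_lepP => j; rewrite mnm1E; case: eqVneq => [<-|//].
rewrite addmC mcoeffD ['X_i * _]mulrC mcoeffMX mcoeff_mderiv addmC.
have -> : ((mu - U_(i))%MM i).+1 = 1%N by rewrite mnmBE mnm1E eqxx; lia.
by rewrite (addrr_pchar2 charF).
Qed.

Lemma MultB lam P Q : Mult lam (P - Q) = Mult lam P - Mult lam Q.
Proof. by rewrite -scaleN1r MultD MultZ scaleN1r. Qed.

Lemma Mult_mulr lam P Q : Mult lam (P * Mult lam Q) = Mult lam (P * Q).
Proof.
apply/esym/eqP; rewrite -subr_eq0 -MultB -mulrBr; apply/eqP.
exact: (Mult_ideal charF) (in_idealM _ (Mult_congr charF lam Q)).
Qed.

(** With P = A + x_i B as in [msupp_free], both sides are x_i A + lam_i B; the right side is written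
    through P and its derivative B. *)
Lemma Mult_mulX lam i P : multilinear P ->
  Mult lam ('X_i * P) = 'X_i * P + ('X_i ^+ 2 + (lam i)%:MP) * P^`M(i).
Proof.
move=> mlP; apply/esym/(Mult_unique charF).
  have -> : 'X_i * P + ('X_i ^+ 2 + (lam i)%:MP) * P^`M(i)
      = 'X_i * (P + 'X_i * P^`M(i)) + lam i *: P^`M(i).
    by rewrite -mul_mpolyC; ring.
  apply: multilinearD; last by apply/multilinearZ/multilinear_mderiv.
  apply: multilinear_mulX; first by move=> mu; apply: msupp_free.
  apply: multilinearD => //; apply: multilinear_mulX; last exact: multilinear_mderiv.
  by move=> mu; apply: mderiv_msupp0.
rewrite opprD addrA subrr add0r oppP mulrC; apply: in_idealM; exact: in_ideal_gen.
Qed.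

Lemma affineE L : (msize L <= 2)%N ->
  L = (L@_0)%:MP + \sum_(l < m) L@_U_(l) *: 'X_l.
Proof.
move=> szL; apply/mpolyP => mu; rewrite mcoeffD mcoeffC raddf_sum /=.
under eq_bigr do rewrite mcoeffZ mcoeffX.
have [mu0|mu2|/eqP/mdeg1P[i /eqP->]] := ltngtP (mdeg mu) 1%N.
- move: mu0; rewrite ltnS leqn0 mdeg_eq0 => /eqP->; rewrite eqxx mulr1 big1 ?addr0 // => l _.
  by rewrite mnm1_eq0 mulr0.
- rewrite (memN_msupp_eq0 (msize_mdeg_ge (leq_trans szL mu2))).
  rewrite -mdeg_eq0 -leqn0 leqNgt (ltnW mu2) mulr0 add0r big1 // => l _.
  by case: eqVneq mu2 => [<-|]; rewrite ?mdeg1 // mulr0.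
rewrite mnm1_eq0 mulr0 add0r (bigD1 i) //= eqxx mulr1 big1 ?addr0 // => l li.
case: eqVneq => [/mnmP/(_ l)|_]; last by rewrite mulr0.
by rewrite !mnm1E eqxx eq_sym (negbTE li).
Qed.

(** By linearity in L, each x_l contributes its correction term from [Mult_mulX], and the constant
    term contributes none. *)
Lemma Mult_mul_affine lam L P : (msize L <= 2)%N -> multilinear P ->
  Mult lam (L * P) = L * P + lift_deriv lam (fun l => L@_U_(l)) P.
Proof.
move=> szL mlP; rewrite {1 2}(affineE szL) !mulrDl MultD mul_mpolyC MultZ Mult_id //.
rewrite -addrA; congr (_ + _); rewrite /lift_deriv.
rewrite !mulr_suml -big_split /=.
elim/big_rec2: _ => [|l Q R _ IH]; first by rewrite Mult0.
by rewrite MultD -IH -scalerAl MultZ Mult_mulX // -scalerDr.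
Qed.

Lemma quad_Mult_mul lam L P : (msize L <= 2)%N -> multilinear P -> quad P ->
  quad (Mult lam (L * P)).
Proof.
move=> szL mlP qP; rewrite Mult_mul_affine //; apply: (quad_mul_affine charF) => // i.
rewrite {1}(affineE szL) mderivD mderivC add0r raddf_sum /= (bigD1 i) //= big1.
  rewrite addr0 mderivZ; have -> : ('X_i)^`M(i) = 1 :> {mpoly F[m]}.
    by rewrite mderivX mnm1E eqxx scale1r -{1}[U_(i)%MM]add0m addmK mpolyX0.
  by rewrite -mul_mpolyC mulr1.
by move=> l li; rewrite mderivZ mderivX mnm1E (negbTE li) scale0r scaler0.
Qed.

(** The product starts from a general P, not from 1, because the elimination of a variable also
    multiplies a solution of the quadrics by affine factors. *)
Lemma quad_Mult_prod lam (Ls : seq {mpoly F[m]}) P :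
  (forall L, L \in Ls -> (msize L <= 2)%N) -> multilinear P -> quad P ->
  quad (Mult lam (P * \prod_(L <- Ls) L)).
Proof.
move=> szLs mlP qP; elim: Ls szLs => [_|L Ls IH szLs].
  by rewrite big_nil mulr1 Mult_id.
rewrite big_cons mulrCA -Mult_mulr; apply: quad_Mult_mul.
- by apply: szLs; rewrite mem_head.
- exact: Mult_multilinear.
- by apply: IH => K KLs; apply: szLs; rewrite inE KLs orbT.
Qed.

Lemma quadC a : quad (a%:MP : {mpoly F[m]}).
Proof. by move=> i j k; rewrite /quad_at !mderivC !mulr0 !addr0. Qed.

Lemma factorizable_quad P : factorizable P -> quad P.
Proof.
move=> [ell [Ls [szLs ->]]]; rewrite -[\prod_(L <- Ls) L]mul1r -mpolyC1.
by apply: quad_Mult_prod => //; [apply: multilinearC|apply: quadC].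
Qed.

End Reduction.

(** * Factoring a point of the quadrics *)

Section Converse.
Variables (F : fieldType) (m : nat).
Hypothesis charF : 2%N \in [pchar F].
Implicit Types (P Q R L : {mpoly F[m]}) (i j k l : 'I_m) (lam ell : 'I_m -> F).

Let addPP P : P + P = 0. Proof. exact: (addrr_pchar2 (pchar2_mpoly m charF)). Qed.
Let oppP P : - P = P. Proof. exact: (oppr_pchar2 (pchar2_mpoly m charF)). Qed.
Let two0 : 2%:R = 0 :> {mpoly F[m]}. Proof. exact: pcharf0 (pchar2_mpoly m charF). Qed.

Definition sqr_fun ell i : F := ell i ^+ 2.

(** In characteristic 2 squaring is a ring morphism, so it suffices to treat constants and
    variables, and x_i^2 is congruent to ell_i^2. *)
Lemma in_ideal_sqr_meval ell P : in_ideal (sqr_fun ell) (P ^+ 2 - (P.@[ell] ^+ 2)%:MP).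
Proof.
pose S R := in_ideal (sqr_fun ell) (R ^+ 2 - (R.@[ell] ^+ 2)%:MP).
have SD Q R : S Q -> S R -> S (Q + R).
  rewrite /S => SQ SR; have := in_idealD SQ SR; congr (in_ideal _ _).
  rewrite mevalD !expr2 !(mpolyCD, mpolyCM).
  transitivity ((Q + R) * (Q + R) - (Q.@[ell]%:MP + R.@[ell]%:MP) * (Q.@[ell]%:MP + R.@[ell]%:MP)
    - 2%:R * (Q * R - Q.@[ell]%:MP * R.@[ell]%:MP)); first by ring.
  by rewrite two0 mul0r subr0.
have SM Q R : S Q -> S R -> S (Q * R).
  rewrite /S => SQ SR.
  have := in_idealD (in_idealM (R ^+ 2) SQ) (in_idealM ((Q.@[ell] ^+ 2)%:MP) SR).
  congr (in_ideal _ _); rewrite mevalM !expr2 !mpolyCM; ring.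
have SC a : S a%:MP by rewrite /S mevalC -rmorphXn subrr; apply: in_ideal0.
have SX i : S 'X_i by rewrite /S mevalXU oppP; apply: in_ideal_gen.
rewrite -/(S P) [P]mpolyE; apply: (big_ind S) => [||mu _]; [by rewrite -mpolyC0|exact: SD|].
rewrite -mul_mpolyC; apply: (SM) => //; rewrite mpolyXE_id.
apply: (big_ind S) => [||i _]; [by rewrite -mpolyC1|exact: SM|].
elim: (mu i) => [|n IH]; first by rewrite expr0 -mpolyC1.
by rewrite exprS; apply: SM.
Qed.

(** Modulo 2 the hypothesis says that no monomial of R has two odd exponents, and reduction keeps
    only the parities of the exponents. *)
Lemma msize_Mult_le2 lam R : (forall j k, R^`M(j)^`M(k) = 0) ->
  (msize (Mult lam R) <= 2)%N.
Proof.
move=> R2; rewrite /Mult big_seq.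
apply: (big_ind (fun Q => (msize Q <= 2)%N)) => [|P Q szP szQ|mu muR].
- by rewrite msize0.
- by rewrite (leq_trans (msizeD_le _ _)) // geq_max szP.
rewrite mult_monomialE scalerA (leq_trans (msizeZ_le _ _)) // msizeX ltnS mdegE.
under eq_bigr do rewrite mnmE.
have [/existsP[j jodd]|/existsPn even] := boolP [exists j, odd (mu j)]; last first.
  by rewrite big1 // => j _; rewrite (negbTE (even j)).
rewrite (bigD1 j) //= jodd big1 // => k kj.
case kodd : (odd (mu k)) => //; have := congr1 (mcoeff (mu - U_(j) - U_(k))%MM) (R2 j k).
rewrite mcoeff0 !mcoeff_mderiv !submK; first last.
- apply/mnm_lepP => l; rewrite mnm1E; case: eqVneq => [<-|//].
  by rewrite mnmBE mnm1E eq_sym (negbTE kj); move: kodd; case: (mu k).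
- by apply/mnm_lepP => l; rewrite mnm1E; case: eqVneq => [<-|//]; move: jodd; case: (mu j).
have -> : ((mu - U_(j))%MM j).+1 = mu j.
  by rewrite mnmBE mnm1E eqxx; move: jodd; case: (mu j) => // n; rewrite subn1.
have -> : ((mu - U_(j) - U_(k))%MM k).+1 = mu k.
  rewrite !mnmBE !mnm1E eqxx eq_sym (negbTE kj) subn0.
  by move: kodd; case: (mu k) => // n; rewrite subn1.
rewrite (mulrn_pchar2 charF _ (mu k)) (mulrn_pchar2 charF _ (mu j)) jodd kodd !mulr1n => R0.
by move: muR; rewrite mcoeff_msupp R0 eqxx.
Qed.

(** A membership certificate modulo y^2, t^2, p A - pi and 2. There (1 + y)(1 + t)(1 + y + t) = 1 +
    y t, times 1 + al y this is 1 + y A, and f = p (1 + y A) with (1 + y A)^2 = 1. *)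
Lemma specialize_identity (T : comPzRingType) (p pi y t al : T) :
  let A := t + al in let f := p + y * pi in
  f * ((1 + al * y) * ((1 + y) * ((1 + t) * (1 + (y + t))))) - p =
  (f * (1 + 2%:R * al + 3%:R * al * t + al * t * t + al * t * y + al * y + t) + p * A ^+ 2) * y ^+ 2
  + f * (1 + al * y + y) * t ^+ 2 - y * (1 + y * A) * (p * A - pi)
  + 2%:R * (f * (al * t * y + t + t * y + y) + p * y * A).
Proof. by move=> A f; rewrite /A /f; ring. Qed.

(** The product is given value 1 at ell so that its square is 1 modulo the ideal. *)
Lemma specialize_mul ell i P : multilinear P -> quad P -> P.@[ell] != 0 ->
  exists2 Ls : seq {mpoly F[m]}, 
      (forall L, L \in Ls -> (msize L <= 2)%N) /\ (\prod_(L <- Ls) L).@[ell] = 1 &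
    in_ideal (sqr_fun ell) ((P + ('X_i + (ell i)%:MP) * P^`M(i)) * (\prod_(L <- Ls) L) - P).
Proof.
move=> mlP qP Pl; set kap := P.@[ell] ^+ 2; set y := 'X_i + _; set f := P + _.
have kap0 : kap != 0 by rewrite expf_neq0.
set lam := sqr_fun ell.
(* As P^2 is the scalar [kap] modulo the ideal, P A is congruent to P_i. *)
pose B := Mult lam (P * P^`M(i)); pose A := kap^-1 *: B.
have yl : y.@[ell] = 0 by rewrite mevalD mevalXU mevalC (addrr_pchar2 charF).
have szA : (msize A <= 2)%N.
  (* The second derivatives of P P_i are the Q_ijk(P), hence zero. *)
  apply: leq_trans (msizeZ_le _ _) _; apply: msize_Mult_le2 => j k.
  rewrite mderivM !mderivD !mderivM.
  by rewrite -[RHS](qP i j k) /quad_at [RHS]addrC !addrA [_ * P^`M(i)]mulrC; ring.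
(* Shifted by its value at ell, A becomes t with t(ell) = 0, so that t^2 lies in the ideal. *)
pose al := A.@[ell]; pose t := A + al%:MP.
have tl : t.@[ell] = 0 by rewrite mevalD mevalC (addrr_pchar2 charF).
have szC a : (msize (a%:MP : {mpoly F[m]}) <= 2)%N by rewrite msizeC; case: eqP.
have szD Q R : (msize Q <= 2)%N -> (msize R <= 2)%N -> (msize (Q + R) <= 2)%N.
  by move=> szQ szR; rewrite (leq_trans (msizeD_le _ _)) // geq_max szQ.
have szy : (msize y <= 2)%N by apply: (szD); rewrite ?msizeX ?mdeg1.
have szt : (msize t <= 2)%N by apply: (szD).
have sz1 : (msize (1 : {mpoly F[m]}) <= 2)%N by rewrite -mpolyC1.
exists [:: 1 + al *: y; 1 + y; 1 + t; 1 + (y + t)]; [split => [L|]|].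
- rewrite !inE => /or4P[]/eqP->; apply: (szD) => //; last exact: szD.
  exact: leq_trans (msizeZ_le _ _) _.
- have v1 Q : Q.@[ell] = 0 -> (1 + Q).@[ell] = 1 by move=> Ql; rewrite mevalD meval1 Ql addr0.
  rewrite !big_cons big_nil !mevalM meval1 !v1 ?mulr1 //.
    by rewrite mevalD yl tl addr0.
  by rewrite mevalZ yl mulr0.
have sq R : R.@[ell] = 0 -> in_ideal lam (R ^+ 2).
  by move=> Rl; have := in_ideal_sqr_meval ell R; rewrite Rl expr0n /= mpolyC0 subr0.
have y2 : in_ideal lam (y ^+ 2) by apply: sq.
have t2 : in_ideal lam (t ^+ 2) by apply: sq.
have P2 : in_ideal lam (P ^+ 2 - kap%:MP) := in_ideal_sqr_meval ell P.
have BA : in_ideal lam (P * P^`M(i) - kap *: A).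
  by rewrite /A scalerA mulfV // scale1r; apply: Mult_congr.
have PA : in_ideal lam (P * A - P^`M(i)).
  have -> : P * A - P^`M(i) = (kap^-1)%:MP *
      (P^`M(i) * (P ^+ 2 - kap%:MP) + - P * (P * P^`M(i) - kap *: A)).
    have -> : P * A - P^`M(i) = (kap^-1 * kap)%:MP * (P * A - P^`M(i)).
      by rewrite mulVf // mpolyC1 mul1r.
    rewrite mpolyCM -mulrA -mul_mpolyC.
    ring.
  by apply/in_idealM/in_idealD; apply: in_idealM.
rewrite !big_cons big_nil mulr1 -mul_mpolyC.
have := specialize_identity P P^`M(i) y t al%:MP.
have -> : t + al%:MP = A by rewrite /t -addrA addPP addr0.
rewrite /= two0 [0 * (_ + _)]mul0r addr0 -/f => ->.
apply: in_idealD; first by apply: in_idealD; apply: in_idealM.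
by rewrite -mulNr; apply: in_idealM.
Qed.


Lemma in_ideal_sym lam P Q : in_ideal lam (P - Q) -> in_ideal lam (Q - P).
Proof. by move=> PQ; rewrite -[Q - P]opprB -mulN1r; apply: in_idealM. Qed.

(** The factor x_i + ell_i vanishes at ell, which preserves the nonzero value needed to eliminate
    the next variable. *)
Lemma specialize_eliminates ell i P : multilinear P -> quad P -> P.@[ell] != 0 ->
  let f := P + ('X_i + (ell i)%:MP) * P^`M(i) in
  [/\ multilinear f, quad f, f.@[ell] = P.@[ell], f^`M(i) = 0
    & forall j, P^`M(j) = 0 -> f^`M(j) = 0].
Proof.
move=> mlP qP Pl f; have mlf : multilinear f.
  rewrite /f mulrDl addrA mul_mpolyC; apply: multilinearD; last first.
    exact/multilinearZ/multilinear_mderiv.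
  apply: multilinearD => //; apply: multilinear_mulX; last exact: multilinear_mderiv.
  by move=> mu; apply: mderiv_msupp0.
have fi : f^`M(i) = 0.
  rewrite mderivD mderivM mderivD mderivC addr0 mderiv_mderiv_pchar2 // mulr0 addr0.
  by rewrite mderivX mnm1E eqxx scale1r -{1}[U_(i)%MM]add0m addmK mpolyX0 mul1r addPP.
split=> //.
- have [Ls [szLs Ls1] Pf] := specialize_mul i mlP qP Pl.
  suff -> : f = Mult (sqr_fun ell) (P * \prod_(L <- Ls) L).
    exact: quad_Mult_prod.
  apply: (Mult_unique charF) => //; rewrite -/f in Pf; move: Ls1 Pf.
  set W := \prod_(L <- Ls) L => W1 Pf.
  (* W is its own inverse modulo the ideal, which turns f W = P into f = P W; multiplication by
     affine factors preserves [quad]. *)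
  have W2 := in_ideal_sqr_meval ell W; rewrite W1 expr1n mpolyC1 in W2.
  apply: in_ideal_sym.
  have -> : f - P * W = W * (f * W - P) + - f * (W ^+ 2 - 1) by ring.
  by apply: in_idealD; apply: in_idealM.
- by rewrite mevalD mevalM mevalD mevalXU mevalC (addrr_pchar2 charF) mul0r addr0.
move=> j Pj; have [->//|ji] := eqVneq j i.
rewrite mderivD mderivM mderivD mderivC addr0 mderiv_comm Pj mderiv0 mulr0 add0r addr0.
by rewrite mderivX mnm1E eq_sym (negbTE ji) scale0r mul0r.
Qed.

(** The point ell is fixed throughout, so that the factors of all eliminations are collected modulo
    one ideal. *)
Lemma quad_reduce ell (s : seq 'I_m) P : multilinear P -> quad P -> P.@[ell] != 0 ->
  exists f (Ls : seq {mpoly F[m]}), [/\ multilinear f, quad f, f.@[ell] != 0,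
    forall j, j \in s -> f^`M(j) = 0 &
    (forall L, L \in Ls -> (msize L <= 2)%N) /\
    in_ideal (sqr_fun ell) (f * (\prod_(L <- Ls) L) - P)].
Proof.
move=> mlP qP Pl; elim: s => [|i s [f [Ls [mlf qf fl fs [szLs Pf]]]]].
  by exists P, [::]; split=> //; split=> //; rewrite big_nil mulr1 subrr; apply: in_ideal0.
have [Ks [szKs _] fg] := specialize_mul i mlf qf fl.
have /= [mlg qg gl gi gs] := specialize_eliminates i mlf qf fl.
move: fg mlg qg gl gi gs; set g := f + _ => fg mlg qg gl gi gs.
exists g, (Ks ++ Ls); split=> //; first by rewrite gl.
  by move=> j; rewrite inE => /orP[/eqP->//|/fs]; apply: gs.
split=> [L|]; first by rewrite mem_cat => /orP[/szKs|/szLs].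
rewrite big_cat /=; set K := \prod_(L <- Ks) L; set M := \prod_(L <- Ls) L.
have -> : g * (K * M) - P = M * (g * K - f) + (f * M - P) by ring.
by apply: in_idealD => //; apply: in_idealM.
Qed.

(** Multilinearity excludes monomials such as x_i^2, which all derivations kill in characteristic
    2. *)
Lemma mderiv0_const P : multilinear P -> (forall i, P^`M(i) = 0) -> P = (P@_0)%:MP.
Proof.
move=> mlP dP; apply/mpolyP => mu; rewrite mcoeffC.
have [->|mu0] := eqVneq mu 0%MM; first by rewrite mulr1.
rewrite mulr0; apply: contraNeq mu0; rewrite -mcoeff_msupp => muP.
apply/eqP/mnmP => i; rewrite mnm0E; apply/eqP; apply/negPn/negP => mui.
have le_i : (U_(i) <= mu)%MM.
  by apply/mnm_lepP => j; rewrite mnm1E; case: eqVneq => [<-|//]; rewrite lt0n.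
have := congr1 (mcoeff (mu - U_(i))%MM) (dP i); rewrite mcoeff0 mcoeff_mderiv submK //.
rewrite mnmBE mnm1E eqxx; have := mlP _ muP i.
case: (mu i) mui => [|[|]] // _ _ /eqP.
by apply/negP; rewrite subnn mulr1n -mcoeff_msupp.
Qed.

(** Evaluate at the 0/1 vector of a monomial mu of least degree: a monomial that is nonzero there
    divides mu, hence equals mu. This works even over the field with two elements. *)
Lemma exists_meval_neq0 P : multilinear P -> P != 0 -> exists ell, P.@[ell] != 0.
Proof.
move=> mlP P0.
have [mu muP mumin] : exists2 mu, mu \in msupp P &
    forall nu, nu \in msupp P -> (mdeg mu <= mdeg nu)%N.
  have : msupp P != [::] by rewrite msupp_eq0.
  elim: (msupp P) => // nu s IH _; have [->|/IH[mu mus mumin]] := eqVneq s [::].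
    by exists nu => [|xi]; rewrite ?inE // => /eqP->.
  have [le|lt] := leqP (mdeg mu) (mdeg nu).
    by exists mu => [|xi]; rewrite inE ?mus ?orbT // => /orP[/eqP->//|/mumin].
  exists nu => [|xi]; rewrite inE ?eqxx // => /orP[/eqP->//|/mumin].
  by apply: leq_trans; apply: ltnW.
exists (fun i => (mu i)%:R); rewrite mevalE (bigD1_seq mu) ?msupp_uniq //= [X in _ + X]big1_seq.
  rewrite addr0 big1 ?mulr1 -?mcoeff_msupp // => i _.
  by have := mlP _ muP i; case: (mu i) => [|[|]] //; rewrite ?expr0 ?expr1.
move=> nu /andP[nu_mu nuP]; apply/eqP; rewrite mulf_eq0; apply/orP; right.
apply: contraNT nu_mu => /prodf_neq0 nz.
have le_nu : (nu <= mu)%MM.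
  apply/mnm_lepP => i; have := nz i isT; have := mlP _ nuP i.
  by case: (mu i) => // le1; case: (nu i) le1 => [|[|]] //; rewrite expr1 eqxx.
have := mumin _ nuP; rewrite -(submK le_nu) mdegD -[X in (_ <= X)%N]add0n leq_add2r.
by rewrite leqn0 mdeg_eq0 => /eqP->; rewrite add0m.
Qed.

Theorem factorizableP P : multilinear P -> factorizable P <-> quad P.
Proof.
move=> mlP; split; first exact: factorizable_quad.
move=> qP; have [->|P0] := eqVneq P 0.
  exists (fun=> 0), [:: 0]; split=> [L|]; first by rewrite inE => /eqP->; rewrite msize0.
  by rewrite big_seq1 Mult0.
have [ell Pl] := exists_meval_neq0 mlP P0.
have [f [Ls [mlf _ _ df [szLs Pf]]]] := quad_reduce (enum 'I_m) mlP qP Pl.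
(* With all variables eliminated f is constant, so it serves as one more affine factor. *)
exists ell, (f :: Ls); split=> [L|].
  rewrite inE => /orP[/eqP->|/szLs//].
  rewrite (@mderiv0_const f) // => [|i]; last by rewrite df ?mem_enum.
  by rewrite msizeC; case: eqP.
rewrite big_cons; exact: (Mult_unique charF).
Qed.

End Converse.

(** * The quadrics as coefficients of the sum of pairwise products *)

Section Pairs.
Variables (F : fieldType) (m : nat).
Hypothesis charF : 2%N \in [pchar F].
Implicit Types (P Q R L : {mpoly F[m]}) (i j k l : 'I_m) (mu nu xi : 'X_{1..m}).

Let addPP P : P + P = 0. Proof. exact: (addrr_pchar2 (pchar2_mpoly m charF)). Qed.

Fixpoint pair_with (x : F * 'X_{1..m}) s acc : seq (F * 'X_{1..m}) :=
  if s is y :: s' then pair_with x s' ((x.1 * y.1, x.2 + y.2)%MM :: acc) else acc.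

(** Lists the terms M_p M_q for p < q without merging equal exponents; the accumulators mirror the
    recursion of the program. *)
Fixpoint all_pairs (s acc : seq (F * 'X_{1..m})) : seq (F * 'X_{1..m}) :=
  if s is x :: s' then all_pairs s' (pair_with x s' acc) else acc.

Definition poly_of (s : seq (F * 'X_{1..m})) : {mpoly F[m]} := \sum_(x <- s) x.1 *: 'X_[x.2].

Lemma poly_of_pair_with x s acc :
  poly_of (pair_with x s acc) = x.1 *: 'X_[x.2] * poly_of s + poly_of acc.
Proof.
elim: s acc => [|y s IH] acc /=; first by rewrite /poly_of big_nil mulr0 add0r.
rewrite IH /poly_of !big_cons /= mulrDr addrCA addrA; congr (_ + _ + _).
by rewrite -scalerAl -scalerAr scalerA mpolyXD.
Qed.

(** Q_ijk is a quadratic form, and by the Leibniz rule its polar form is d_i d_j d_k (P Q). *)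
Lemma quad_atD i j k P Q :
  quad_at i j k (P + Q) = (P * Q)^`M(i)^`M(j)^`M(k) + quad_at i j k P + quad_at i j k Q.
Proof. rewrite /quad_at !(mderivM, mderivD); ring. Qed.

Lemma mulX_mderivX i mu : 'X_i * ('X_[mu])^`M(i) = (mu i)%:R *: 'X_[mu] :> {mpoly F[m]}.
Proof.
rewrite mderivX -scalerAr -mpolyXD; have [->|mui] := posnP (mu i); first by rewrite !scale0r.
by rewrite addmC submK //; apply/mnm_lepP => j; rewrite mnm1E; case: eqVneq => [<-|].
Qed.

Lemma quad_distinct P :
  (forall i j k, i != j -> i != k -> j != k -> quad_at i j k P = 0) -> quad P.
Proof.
move=> qP i j k; have [->|ij] := eqVneq i j; first exact: quad_at_diag.
have [->|ik] := eqVneq i k.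
  rewrite /quad_at [_^`M(k)^`M(j)]mderiv_comm !mderiv_mderiv_pchar2 //.
  by rewrite !mulr0 add0r addr0 addPP.
have [->|jk] := eqVneq j k; last exact: qP.
by rewrite /quad_at !mderiv_mderiv_pchar2 // !mulr0 !add0r addPP.
Qed.

(** After multiplication by x_i x_j x_k, each of the four products becomes the same multiple of the
    square of the monomial, and 4 = 0. *)
Lemma quad_monomial (a : F) mu : quad (a *: 'X_[mu]).
Proof.
apply: quad_distinct => i j k ij ik jk.
pose X l : {mpoly F[m]} := 'X_l; pose M : {mpoly F[m]} := 'X_[mu].
pose d l : {mpoly F[m]} := (mu l)%:R%:MP.
have d1 l : X l * M^`M(l) = d l * M by rewrite mulX_mderivX mul_mpolyC.
have dX l n : l != n -> (X l)^`M(n) = 0.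
  by move=> ln; rewrite mderivX mnm1E (negbTE ln) scale0r.
have d2 l n : l != n -> X l * X n * M^`M(l)^`M(n) = d l * d n * M.
  move=> ln; have := congr1 (mderiv n) (d1 l).
  rewrite !mderivM dX // mderivC !mul0r !add0r => /(congr1 ( *%R (X n))) E.
  by rewrite -[LHS]mulrA mulrCA E mulrCA d1 mulrA.
have d3 : X i * X j * X k * M^`M(i)^`M(j)^`M(k) = d i * d j * d k * M.
  have := congr1 (mderiv k) (d2 i j ij).
  rewrite !mderivM !dX // !mderivC !(mul0r, mulr0, add0r) => /(congr1 ( *%R (X k))) E.
  by rewrite [_ * X k]mulrC -[LHS]mulrA E mulrCA d1 mulrA.
have XN0 l : X l != 0 by rewrite -msupp_eq0 msuppX.
apply: (mulfI (mulf_neq0 (mulf_neq0 (XN0 i) (XN0 j)) (XN0 k))); rewrite mulr0.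
rewrite /quad_at !mderivZ -!mul_mpolyC -/M.
transitivity (a%:MP * a%:MP * (M * (X i * X j * X k * M^`M(i)^`M(j)^`M(k))
   + (X i * M^`M(i)) * (X j * X k * M^`M(j)^`M(k))
   + (X j * M^`M(j)) * (X i * X k * M^`M(i)^`M(k))
   + (X k * M^`M(k)) * (X i * X j * M^`M(i)^`M(j)))); first by ring.
rewrite d3 !d1 !d2 //.
transitivity (a%:MP * a%:MP * (d i * d j * d k * M * M * 2%:R * 2%:R)); first by ring.
by rewrite (pcharf0 (pchar2_mpoly m charF)) !mulr0.
Qed.

(** A quadratic form that vanishes on every term reduces to its polar form on pairs of terms. *)
Lemma quad_at_poly_of i j k s :
  quad_at i j k (poly_of s) = (poly_of (all_pairs s [::]))^`M(i)^`M(j)^`M(k).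
Proof.
suff gen acc : (poly_of (all_pairs s acc))^`M(i)^`M(j)^`M(k)
    = quad_at i j k (poly_of s) + (poly_of acc)^`M(i)^`M(j)^`M(k).
  by rewrite gen /poly_of big_nil !mderiv0 addr0.
elim: s acc => [|x s IH] acc /=.
  by rewrite {2}/poly_of big_nil /quad_at !mderiv0 !mulr0 !addr0 add0r.
rewrite IH poly_of_pair_with [poly_of (x :: s)]big_cons -/(poly_of s).
rewrite quad_atD quad_monomial addr0 !mderivD.
by rewrite addrCA addrA.
Qed.

Definition odd_entries xi : nat := count (fun i => odd (xi i)) (enum 'I_m).

Lemma mcoeff_poly_of s xi : (poly_of s)@_xi = \sum_(z <- s | z.2 == xi) z.1.
Proof.
rewrite raddf_sum /= [RHS]big_mkcond; apply: eq_bigr => z _ /=.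
by rewrite mcoeffZ mcoeffX; case: eqP; rewrite ?mulr1 ?mulr0.
Qed.

(** For distinct i, j, k the derivative multiplies the coefficient at xi by xi_i xi_j xi_k, which
    survives modulo 2 exactly when the three entries are odd. *)
Lemma mderiv3_eq0 Q :
  (forall i j k, i != j -> i != k -> j != k -> Q^`M(i)^`M(j)^`M(k) = 0) <->
  (forall xi, (3 <= odd_entries xi)%N -> Q@_xi = 0).
Proof.
split=> [d3 xi xi3|Q0 i j k ij ik jk].
  have [i [j [k [ij ik jk [oi oj ok]]]]] : exists i j k, [/\ i != j, i != k, j != k
      & [/\ odd (xi i), odd (xi j) & odd (xi k)]].
    have := filter_uniq (fun i => odd (xi i)) (enum_uniq 'I_m).
    move: xi3; rewrite /odd_entries -size_filter.
    have /allP : all (fun i => odd (xi i)) [seq i <- enum 'I_m | odd (xi i)] by apply: filter_all.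
    case: filter => [|i [|j [|k s]]] //= odd_s _ /and4P[].
    rewrite !inE !negb_or => /and3P[ij ik _] /andP[jk _] _ _.
    exists i, j, k; split=> //; split; apply: odd_s; rewrite !inE eqxx ?orbT //.
  have le1 l : odd (xi l) -> (U_(l) <= xi)%MM.
    by move=> ol; apply/mnm_lepP => n; rewrite mnm1E; case: eqVneq ol => // <-; case: (xi l).
  have := congr1 (mcoeff (xi - U_(i) - U_(j) - U_(k))%MM) (d3 i j k ij ik jk).
  have lek : (U_(k) <= xi - U_(i) - U_(j))%MM.
    apply/mnm_lepP => n; rewrite !mnmBE !mnm1E; case: eqVneq => // <-.
    by rewrite (negbTE ik) (negbTE jk) !subn0; case: (xi k) ok.
  have lej : (U_(j) <= xi - U_(i))%MM.
    apply/mnm_lepP => n; rewrite !mnmBE !mnm1E; case: eqVneq => // <-.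
    by rewrite (negbTE ij) subn0; case: (xi j) oj.
  rewrite mcoeff0 !mcoeff_mderiv !submK ?le1 //.
  rewrite (mulrn_pchar2 charF _ (_ k).+1) (mulrn_pchar2 charF _ (_ j).+1).
  rewrite (mulrn_pchar2 charF _ (_ i).+1) !mnmBE !mnm1E !eqxx.
  rewrite (negbTE ij) (negbTE ik) (negbTE jk) !subn0.
  have -> : odd (xi i - true).+1 by case: (xi i) oi => // n; rewrite subn1.
  have -> : odd (xi j - true).+1 by case: (xi j) oj => // n; rewrite subn1.
  by have -> : odd (xi k - true).+1 by case: (xi k) ok => // n; rewrite subn1.
apply/mpolyP => e; rewrite mcoeff0 !mcoeff_mderiv.
rewrite (mulrn_pchar2 charF _ (_ k).+1) (mulrn_pchar2 charF _ (_ j).+1).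
rewrite (mulrn_pchar2 charF _ (_ i).+1) !mnmDE !mnm1E.
rewrite (negbTE _ : (k == j) = false); last by rewrite eq_sym.
rewrite (negbTE _ : (k == i) = false); last by rewrite eq_sym.
rewrite (negbTE _ : (j == i) = false); last by rewrite eq_sym.
rewrite !addn0; set xi := (e + _ + _ + _)%MM.
have xiE l : xi l = (e l + (k == l) + (j == l) + (i == l))%N by rewrite !mnmDE !mnm1E.
have [xi3|] := boolP (3 <= odd_entries xi)%N; first by rewrite Q0 // !mul0rn.
move=> xi3; case oi: (odd (e i).+1); last by rewrite !mul0rn.
case oj: (odd (e j).+1); last by rewrite mulr1n !mul0rn.
case ok: (odd (e k).+1); last by rewrite mulr0n.
case/negP: xi3; rewrite /odd_entries -size_filter.
suff : {subset [:: i; j; k] <= [seq l <- enum 'I_m | odd (xi l)]}.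
  by apply: uniq_leq_size; rewrite /= !inE negb_or ij ik jk.
move=> l; rewrite mem_filter mem_enum andbT !inE.
have xi_i : xi i = (e i).+1.
  by rewrite xiE eqxx [k == i]eq_sym [j == i]eq_sym (negbTE ij) (negbTE ik) !addn0 addn1.
have xi_j : xi j = (e j).+1.
  by rewrite xiE eqxx [k == j]eq_sym (negbTE ij) (negbTE jk) !addn0 addn1.
have xi_k : xi k = (e k).+1.
  by rewrite xiE eqxx (negbTE ik) (negbTE jk) !addn0 addn1.
by case/or3P=> /eqP->; rewrite ?xi_i ?xi_j ?xi_k.
Qed.

Definition quad_test (Z : seq (F * 'X_{1..m})) (z : F * 'X_{1..m}) : bool :=
  (3 <= odd_entries z.2)%N ==> (\sum_(y <- Z | y.2 == z.2) y.1 == 0).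

(** Testing the exponents that occur in Z suffices: at any other one the coefficient is an empty
    sum. *)
Lemma quad_testP s : let Z := all_pairs s [::] in
  reflect (quad (poly_of s)) (all (quad_test Z) Z).
Proof.
move=> Z; apply: (iffP allP) => [ok|qs z zZ].
  have H0 : forall xi, (3 <= odd_entries xi)%N -> (poly_of Z)@_xi = 0.
    move=> xi xi3; rewrite mcoeff_poly_of.
    have [/hasP[z zZ /eqP zxi]|/hasPn noz] := boolP (has (fun z => z.2 == xi) Z); last first.
      by rewrite big1_seq // => z /andP[zxi /noz]; rewrite zxi.
    by have := ok z zZ; rewrite /quad_test zxi xi3 => /eqP.
  apply: quad_distinct => i j k; rewrite quad_at_poly_of; move: i j k.
  exact/mderiv3_eq0.
apply/implyP => z3; rewrite -mcoeff_poly_of; apply/eqP; move: z3; move: z.2.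
apply/mderiv3_eq0 => i j k _ _ _.
by rewrite -quad_at_poly_of.
Qed.

End Pairs.

(** * The program and its running time *)

Section Algorithm.
Variable F : fieldType.
Hypothesis charF : 2%N \in [pchar F].

Let arg : expr F := Var F 0.

(** A nonempty list is a [Node], hence true, and the empty one is [Leaf 0], hence false: [If] on a
    list tests for emptiness. *)
Definition vec_add_body : expr F :=
  If (Fst arg)
    (Pair (Pair (Add (Fst (Fst arg)) (Fst (Snd arg))) (Mul (Fst (Fst arg)) (Fst (Snd arg))))
          (Call 1 (Pair (Snd (Fst arg)) (Snd (Snd arg)))))
    (Cst 0).

Definition pair_with_body : expr F :=
  If (Fst (Snd arg))
    (Call 2 (Pair (Fst arg) (Pair (Snd (Fst (Snd arg)))
      (Pair (Pair (Mul (Fst (Fst arg)) (Fst (Fst (Fst (Snd arg)))))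
                  (Call 1 (Pair (Snd (Fst arg)) (Snd (Fst (Fst (Snd arg)))))))
            (Snd (Snd arg))))))
    (Snd (Snd arg)).

Definition all_pairs_body : expr F :=
  If (Fst arg)
    (Call 3 (Pair (Snd (Fst arg))
      (Call 2 (Pair (Fst (Fst arg)) (Pair (Snd (Fst arg)) (Snd arg))))))
    (Snd arg).

(** In characteristic 2 two bits are equal exactly when their sum is 0, so [Add] serves as
    comparison. *)
Definition vec_eq_body : expr F :=
  If (Fst arg)
    (If (Add (Fst (Fst (Fst arg))) (Fst (Fst (Snd arg)))) (Cst 0)
      (If (Add (Snd (Fst (Fst arg))) (Snd (Fst (Snd arg)))) (Cst 0)
        (Call 4 (Pair (Snd (Fst arg)) (Snd (Snd arg))))))
    (Cst 1).

Definition coef_sum_body : expr F :=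
  If (Snd arg)
    (Add (If (Call 4 (Pair (Fst arg) (Snd (Fst (Snd arg))))) (Fst (Fst (Snd arg))) (Cst 0))
         (Call 5 (Pair (Fst arg) (Snd (Snd arg)))))
    (Cst 0).

(** The first component is a unary counter, shortened at each odd entry; the answer is True once it
    is empty. *)
Definition odd_ge_body : expr F :=
  If (Fst arg)
    (If (Snd arg)
      (Call 6 (Pair (If (Fst (Fst (Snd arg))) (Snd (Fst arg)) (Fst arg)) (Snd (Snd arg))))
      (Cst 0))
    (Cst 1).

(** The constant passed to function 6 is 3 in unary. *)
Definition check_body : expr F :=
  If (Fst arg)
    (If (If (Call 6 (Pair (Pair (Cst 0) (Pair (Cst 0) (Pair (Cst 0) (Cst 0))))
                          (Snd (Fst (Fst arg)))))
            (Call 5 (Pair (Snd (Fst (Fst arg))) (Snd arg)))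
            (Cst 0))
      (Cst 0)
      (Call 7 (Pair (Snd (Fst arg)) (Snd arg))))
    (Cst 1).

(** Inside the [Let], variable 0 is the list of products, which is both traversed and searched. *)
Definition main_body : expr F :=
  Let (Call 3 (Pair (Snd arg) (Cst 0))) (Call 7 (Pair (Var F 0) (Var F 0))).

Definition quad_program : program F :=
  [:: main_body; vec_add_body; pair_with_body; all_pairs_body; vec_eq_body;
      coef_sum_body; odd_ge_body; check_body].

Lemma eval_conv env e v v' t t' :
  eval quad_program env e v t -> v = v' -> t = t' -> eval quad_program env e v' t'.
Proof. by move=> ev <- <-. Qed.

Ltac branch := solve [by rewrite /= ?mulr0n ?mulr1n ?eqxx ?oner_eq0 | assumption].

(** Symbolic execution directed by the expression; calls are closed by evaluation hypotheses in the
    context. *)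
Ltac ev :=
  lazymatch goal with
  | |- eval _ _ arg _ _ => eapply EvalVar
  | |- eval _ _ (Var _ _) _ _ => eapply EvalVar
  | |- eval _ _ (Cst _) _ _ => eapply EvalCst
  | |- eval _ _ (Pair _ _) _ _ => eapply EvalPair; [ev | ev]
  | |- eval _ _ (Fst _) _ _ => eapply EvalFst; ev
  | |- eval _ _ (Snd _) _ _ => eapply EvalSnd; ev
  | |- eval _ _ (Add _ _) _ _ => eapply EvalAdd; [ev | ev]
  | |- eval _ _ (Mul _ _) _ _ => eapply EvalMul; [ev | ev]
  | |- eval _ _ (Let _ _) _ _ => eapply EvalLet; [ev | ev]
  | |- eval _ _ (Call _ _) _ _ => eapply EvalCall; [ev | eassumption]
  | |- eval _ _ (If _ _ _) _ _ =>
      first [eapply EvalIfTrue; [ev | branch | ev] | eapply EvalIfFalse; [ev | branch | ev]]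
  end.

Ltac run_body b :=
  eexists; last (eapply eval_conv;
    [change (body quad_program _) with b; rewrite /b; ev | | reflexivity]).

(** * Correctness and cost of each function *)

Variable m : nat.
Implicit Types (mu nu xi : 'X_{1..m}) (r : seq 'I_m) (s acc Y Z : seq (F * 'X_{1..m})).

Definition encode_bits r mu : tree F := encode_list [seq Leaf (mu i)%:R | i <- r].

(* The entry e in {0, 1, 2} of the exponent vector of a product of two
   multilinear monomials x^mu x^nu is stored as the pair (mu + nu, mu * nu) of
   elements of F, i.e. as its parity and whether it is 2. *)
Definition encode_exps r xi : tree F :=
  encode_list [seq Node (Leaf (odd (xi i))%:R) (Leaf (xi i == 2%N)%:R) | i <- r].

Definition encode_term (x : F * 'X_{1..m}) : tree F :=
  Node (Leaf x.1) (encode_bits (enum 'I_m) x.2).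

Definition encode_product (z : F * 'X_{1..m}) : tree F :=
  Node (Leaf z.1) (encode_exps (enum 'I_m) z.2).

Lemma eval_vec_add r mu nu : (forall i, mu i <= 1)%N -> (forall i, nu i <= 1)%N ->
  exists2 t, (t <= 30 * (size r).+1)%N &
  eval quad_program [:: Node (encode_bits r mu) (encode_bits r nu)]
    (body quad_program 1) (encode_exps r (mu + nu)%MM) t.
Proof.
move=> mu1 nu1; elim: r => [|i r [t le_t IH]].
  run_body vec_add_body; last by [].
  by [].
run_body vec_add_body.
  by rewrite /=; lia.
rewrite /=; congr (Node (Node (Leaf _) (Leaf _)) _); rewrite mnmDE.
  by have := mu1 i; have := nu1 i; case: (mu i) => [|[|]] //; case: (nu i) => [|[|]] // _ _;
    rewrite ?addr0 ?add0r // (addrr_pchar2 charF).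
by have := mu1 i; have := nu1 i; case: (mu i) => [|[|]] //; case: (nu i) => [|[|]] // _ _;
  rewrite ?mulr0 ?mul0r ?mulr1.
Qed.


Lemma addb_pchar2 (a b : bool) : a%:R + b%:R = (a != b)%:R :> F.
Proof. by case: a b => [] []; rewrite ?addr0 ?add0r // (addrr_pchar2 charF). Qed.

(** An entry at most 2 is determined by its parity and by whether it is 2, so comparing codes
    decides equality. *)
Lemma eval_vec_eq r xi nu : (forall i, xi i <= 2)%N -> (forall i, nu i <= 2)%N ->
  exists2 t, (t <= 40 * (size r).+1)%N &
  eval quad_program [:: Node (encode_exps r xi) (encode_exps r nu)]
    (body quad_program 4) (encode_bool F (all (fun i => xi i == nu i) r)) t.
Proof.
move=> xi2 nu2; elim: r => [|i r [t le_t IH]]; first by run_body vec_eq_body.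
have [odd_eq|odd_ne] := eqVneq (odd (xi i)) (odd (nu i)); last first.
  have C : tree_true (tree_op2 +%R (Leaf (odd (xi i))%:R : tree F) (Leaf (odd (nu i))%:R)).
    by rewrite /= addb_pchar2 odd_ne oner_eq0.
  run_body vec_eq_body; first by rewrite /=; lia.
  by have /negbTE xi_nu : xi i != nu i by [apply: contraNneq odd_ne => ->]; rewrite /= xi_nu.
have C1 : ~~ tree_true (tree_op2 +%R (Leaf (odd (xi i))%:R : tree F) (Leaf (odd (nu i))%:R)).
  by rewrite /= addb_pchar2 odd_eq eqxx eqxx.
have [two_eq|two_ne] := eqVneq (xi i == 2%N) (nu i == 2%N); last first.
  have C2 : tree_true (tree_op2 +%R (Leaf (xi i == 2%N)%:R : tree F) (Leaf (nu i == 2%N)%:R)).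
    by rewrite /= addb_pchar2 two_ne oner_eq0.
  run_body vec_eq_body; first by rewrite /=; lia.
  by have /negbTE xi_nu : xi i != nu i by [apply: contraNneq two_ne => ->]; rewrite /= xi_nu.
have C2 : ~~ tree_true (tree_op2 +%R (Leaf (xi i == 2%N)%:R : tree F) (Leaf (nu i == 2%N)%:R)).
  by rewrite /= addb_pchar2 two_eq eqxx eqxx.
run_body vec_eq_body; first by rewrite /=; lia.
rewrite /=; suff -> : xi i == nu i by [].
have := xi2 i; have := nu2 i; move: odd_eq two_eq.
by case: (xi i) => [|[|[|]]] //; case: (nu i) => [|[|[|]]].
Qed.

Lemma eval_odd_ge r q xi :
  exists2 t, (t <= 40 * (size r).+1)%N &
  eval quad_program [:: Node (encode_list (nseq q (nil_tree F))) (encode_exps r xi)]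
    (body quad_program 6) (encode_bool F (q <= count (fun i => odd (xi i)) r)%N) t.
Proof.
elim: r q => [|i r IH] [|q].
- by run_body odd_ge_body.
- by run_body odd_ge_body.
- by run_body odd_ge_body; rewrite //=; lia.
have [t le_t ev_t] := IH (if odd (xi i) then q else q.+1); move: ev_t.
case oi: (odd (xi i)) => ev_t.
  have C : tree_true (Leaf (odd (xi i))%:R : tree F) by rewrite /= oi oner_eq0.
  by run_body odd_ge_body; [rewrite /=; lia | rewrite /= oi /= add1n ltnS].
have C : ~~ tree_true (Leaf (odd (xi i))%:R : tree F) by rewrite /= oi eqxx.
by run_body odd_ge_body; [rewrite /=; lia | rewrite /= oi /= add0n].
Qed.

Lemma eval_pair_with (x : F * 'X_{1..m}) s acc :
  (forall i, x.2 i <= 1)%N -> (forall y, y \in s -> forall i, y.2 i <= 1)%N ->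
  exists2 t, (t <= (30 * m + 90) * (size s).+1)%N &
  eval quad_program
    [:: Node (encode_term x) (Node (encode_list [seq encode_term y | y <- s])
          (encode_list [seq encode_product z | z <- acc]))]
    (body quad_program 2) (encode_list [seq encode_product z | z <- pair_with x s acc]) t.
Proof.
move=> x1; elim: s acc => [|y s IH] acc s1.
  by run_body pair_with_body; rewrite //=; lia.
have [t le_t ev_t] := IH ((x.1 * y.1, x.2 + y.2)%MM :: acc)
  (fun z zs => s1 z (@mem_behead _ (y :: s) z zs)).
(* The vector addition costs at most 30 (m + 1); the other 60 units of 30 m + 90 cover the rest of
   the body. *)
have [u le_u ev_u] := eval_vec_add (enum 'I_m) x1 (s1 y (mem_head _ _)).
rewrite size_enum_ord in le_u.
by run_body pair_with_body; rewrite //= mulnS; lia.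
Qed.

(** The bound [n] stays fixed while s shrinks, which gives a uniform cost per element. *)
Lemma eval_all_pairs n s acc :
  (forall y, y \in s -> forall i, y.2 i <= 1)%N -> (size s <= n)%N ->
  exists2 t, (t <= ((30 * m + 90) * n + 30) * (size s).+1)%N &
  eval quad_program
    [:: Node (encode_list [seq encode_term y | y <- s])
          (encode_list [seq encode_product z | z <- acc])]
    (body quad_program 3) (encode_list [seq encode_product z | z <- all_pairs s acc]) t.
Proof.
elim: s acc => [|x s IH] acc s1 szs.
  by run_body all_pairs_body; rewrite //=; lia.
have s1' := fun z zs => s1 z (@mem_behead _ (x :: s) z zs).
have [t le_t ev_t] := IH (pair_with x s acc) s1' (ltnW szs).
have [u le_u ev_u] := eval_pair_with acc (s1 x (mem_head _ _)) s1'.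
have {}le_u : (u <= (30 * m + 90) * n)%N by apply: leq_trans le_u _; rewrite leq_mul2l szs orbT.
by run_body all_pairs_body; rewrite //= mulnS; lia.
Qed.

Lemma eval_coef_sum xi Z :
  (forall i, xi i <= 2)%N -> (forall y, y \in Z -> forall i, y.2 i <= 2)%N ->
  exists2 t, (t <= (40 * m + 90) * (size Z).+1)%N &
  eval quad_program
    [:: Node (encode_exps (enum 'I_m) xi) (encode_list [seq encode_product z | z <- Z])]
    (body quad_program 5) (Leaf (\sum_(y <- Z | y.2 == xi) y.1)) t.
Proof.
move=> xi2; elim: Z => [|y Z IH] Z2.
  by run_body coef_sum_body; rewrite ?big_nil //=; lia.
have [t le_t ev_t] := IH (fun z zs => Z2 z (@mem_behead _ (y :: Z) z zs)).
have [u le_u] := eval_vec_eq (enum 'I_m) xi2 (Z2 y (mem_head _ _)).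
rewrite size_enum_ord in le_u.
have -> : all (fun i => xi i == y.2 i) (enum 'I_m) = (y.2 == xi).
  apply/allP/eqP => [eq_xi|-> //]; apply/mnmP => i.
  by apply/esym/eqP/eq_xi; rewrite mem_enum.
rewrite big_cons; case: eqP => _ ev_u.
  have C : tree_true (encode_bool F true) by rewrite /= oner_eq0.
  by run_body coef_sum_body; rewrite //= mulnS; lia.
have C : ~~ tree_true (encode_bool F false) by rewrite /= eqxx.
by run_body coef_sum_body; rewrite /= ?add0r // mulnS; lia.
Qed.

(** The traversed list Y is kept apart from the searched list Z for the induction; the program
    starts with both equal. *)
Lemma eval_check Y Z :
  (forall y, y \in Y -> forall i, y.2 i <= 2)%N ->
  (forall y, y \in Z -> forall i, y.2 i <= 2)%N ->
  exists2 t, (t <= ((40 * m + 90) * (size Z).+1 + 40 * m + 100) * (size Y).+1)%N &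
  eval quad_program
    [:: Node (encode_list [seq encode_product z | z <- Y])
             (encode_list [seq encode_product z | z <- Z])]
    (body quad_program 7) (encode_bool F (all (quad_test Z) Y)) t.
Proof.
move=> Y2 Z2; elim: Y Y2 => [|y Y IH] Y2.
  by run_body check_body; rewrite //=; lia.
have [t le_t ev_t] := IH (fun z zs => Y2 z (@mem_behead _ (y :: Y) z zs)).
have [u le_u] := eval_odd_ge (enum 'I_m) 3 y.2.
rewrite size_enum_ord in le_u.
have [w le_w ev_w] := eval_coef_sum (Y2 y (mem_head _ _)) Z2.
rewrite -/(odd_entries y.2) -[all _ (y :: Y)]/(quad_test Z y && all (quad_test Z) Y).
rewrite {1}/quad_test; case: (3 <= odd_entries y.2)%N => ev_u; last first.
  have C : ~~ tree_true (encode_bool F false) by rewrite /= eqxx.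
  by run_body check_body; rewrite //= mulnS; lia.
have C : tree_true (encode_bool F true) by rewrite /= oner_eq0.
have [sum0|sum_ne0] := eqVneq (\sum_(x <- Z | x.2 == y.2) x.1) 0; last first.
  by run_body check_body; rewrite //= mulnS; lia.
have C0 : ~~ tree_true (Leaf (\sum_(x <- Z | x.2 == y.2) x.1)) by rewrite /= sum0 eqxx.
by run_body check_body; rewrite //= mulnS; lia.
Qed.

Lemma size_pair_with (x : F * 'X_{1..m}) s acc : size (pair_with x s acc) = (size s + size acc)%N.
Proof. by elim: s acc => //= y s IH acc; rewrite IH addnS. Qed.

Lemma size_all_pairs s acc : (size (all_pairs s acc) <= size s * size s + size acc)%N.
Proof.
elim: s acc => //= x s IH acc; apply: leq_trans (IH _) _.
by rewrite size_pair_with mulSn mulnS; lia.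
Qed.

Lemma mem_pair_with (x : F * 'X_{1..m}) s acc z : z \in pair_with x s acc ->
  z \in acc \/ exists2 y, y \in s & z.2 = (x.2 + y.2)%MM.
Proof.
elim: s acc => [|y s IH] acc /=; first by left.
case/IH => [|[w ws zw]]; last by right; exists w; rewrite // inE ws orbT.
rewrite inE => /orP[/eqP->|]; last by left.
by right; exists y; rewrite ?mem_head.
Qed.

Lemma all_pairs_le2 s acc :
  (forall y, y \in s -> forall i, y.2 i <= 1)%N ->
  (forall y, y \in acc -> forall i, y.2 i <= 2)%N ->
  (forall y, y \in all_pairs s acc -> forall i, y.2 i <= 2)%N.
Proof.
elim: s acc => [|x s IH] acc //= s1 acc2; apply: IH => [y ys|y].
  by apply: s1; rewrite inE ys orbT.
case/mem_pair_with => [|[w ws ->] i]; first exact: acc2.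
have x1 := s1 x (mem_head _ _) i; have w1 : (w.2 i <= 1)%N by apply: s1; rewrite inE ws orbT.
by rewrite mnmDE; lia.
Qed.

Lemma eval_main s (a : tree F) : (forall y, y \in s -> forall i, y.2 i <= 1)%N ->
  exists2 t, (t <= 1000 * (m + size s + 1) ^ 5)%N &
  runs quad_program (Node a (encode_list [seq encode_term y | y <- s]))
    (encode_bool F (let Z := all_pairs s [::] in all (quad_test Z) Z)) t.
Proof.
move=> s1; set Z := all_pairs s [::].
have [t le_t ev_t] := eval_all_pairs [::] s1 (leqnn _).
have Z2 : forall y, y \in Z -> forall i, (y.2 i <= 2)%N by apply: all_pairs_le2.
have [u le_u ev_u] := eval_check Z2 Z2.
have szZ := size_all_pairs s [::]; rewrite addn0 -/Z in szZ.
rewrite /runs; run_body main_body; last by [].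
(* Listing the pairs costs O(n^3). The check visits fewer than n^2 products at O(n^3) each, whence
   the exponent 5. *)
set n := (m + size s + 1)%N.
have n1 : (1 <= n)%N by rewrite /n addn1.
have Z1 : ((size Z).+1 <= n * n)%N by rewrite /n; nia.
have nn1 : (1 <= n * n)%N by rewrite muln_gt0 n1.
have {}le_t : (t <= 120 * (n * n) * n)%N.
  apply: leq_trans le_t (leq_mul _ _); last by rewrite /n; lia.
  have : ((30 * m + 90) * size s <= 90 * n * n)%N by apply: leq_mul; rewrite /n; lia.
  by rewrite -mulnA; lia.
have nn3 : (n <= n * n * n)%N by rewrite leq_pmull.
have {}le_u : (u <= 190 * (n * n * n) * (n * n))%N.
  apply: leq_trans le_u (leq_mul _ Z1).
  have : ((40 * m + 90) * (size Z).+1 <= 90 * n * (n * n))%N.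
    by apply: leq_mul => //; rewrite /n; lia.
  have : (40 * m + 100 <= 100 * n)%N by rewrite /n; lia.
  rewrite -mulnA [(n * (n * n))%N]mulnA; lia.
have -> : (n ^ 5 = n * n * n * (n * n))%N by rewrite !expnS expn0; lia.
have nnn1 : (1 <= n * n * n)%N by rewrite muln_gt0 nn1.
have n35 : (n * n * n <= n * n * n * (n * n))%N by rewrite leq_pmulr.
by move: le_t le_u; rewrite -!mulnA in n35 nnn1 *; lia.
Qed.

End Algorithm.

(* s lists the nonzero monomials of P, in an arbitrary order. *)
Theorem theorem5p8 (F : finFieldType) (charF : 2%N \in [pchar F]) :
  exists (p : program F) (c k : nat),
    forall (m : nat) (P : {mpoly F[m]}) (s : seq 'X_{1..m}),
      multilinear P -> perm_eq s (msupp P) ->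
      exists (answer : bool) (time : nat),
        [/\ runs p (encode_poly P s) (encode_bool F answer) time,
            answer <-> factorizable P
          & (time <= c * (m + size s + 1) ^ k)%N].
Proof.
exists (quad_program F), 1000, 5 => m P s mlP sP.
pose S := [seq (P@_mu, mu) | mu <- s].
have S1 y : y \in S -> forall i, (y.2 i <= 1)%N.
  by case/mapP=> mu mus -> i; apply: mlP; rewrite -(perm_mem sP).
have PS : poly_of S = P by rewrite /poly_of big_map [RHS]mpolyE (perm_big _ sP).
have [t le_t run_t] := eval_main charF (encode_list (nseq m (nil_tree F))) S1.
(* After fusing the maps, [encode_term] of a pair in S is convertible to [encode_monomial]. *)
rewrite size_map in le_t; rewrite -map_comp in run_t.
exists (all (quad_test (all_pairs S [::])) (all_pairs S [::])), t; split=> //.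
by rewrite (factorizableP charF mlP) -PS; split=> /(quad_testP charF).
Qed.
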